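(* A restriction functor $F\colon\mathcal{C}\to\mathcal{D}$ between restriction categories is hyperconnected if and only if the $2$-functor $\Gamma F\colon\Gamma\mathcal{C}\to\Gamma\mathcal{D}$ is a local discrete fibration.
   Context: A restriction category is a category $\mathcal{C}$ with an operation assigning to each $f\colon A\to B$ a map $\bar f\colon A\to A$ such that: (R1) $f\bar f=f$; (R2) $\bar f\bar g=\bar g\bar f$ for $f\colon A\to B$, $g\colon A\to C$; (R3) $\overline{g\bar f}=\bar g\bar f$ for $f\colon A\to B$, $g\colon A\to C$; (R4) $\bar g f=f\,\overline{gf}$ for $f\colon A\to B$, $g\colon B\to C$. A restriction functor is a functor with $F\bar f=\overline{Ff}$. Each homset is partially ordered by $f\leqslant g$ iff $g\bar f=f$; composition and restriction functors preserve this order. $\Gamma\mathcal{C}$ is the $2$-category with underlying category that of $\mathcal{C}$ and a unique $2$-cell $f\Rightarrow g$ exactly when $f\leqslant g$; $\Gamma F$ is the $2$-functor acting as $F$ does. A restriction idempotent on $A$ is an endomorphism $e$ with $\bar e=e$; $\mathcal{O}(A)$ is the set of these. $F$ is hyperconnected if each map $\mathcal{O}(A)\to\mathcal{O}(FA)$, $e\mapsto Fe$, is an isomorphism (bijection). A functor $p\colon\mathcal{E}\to\mathcal{B}$ is a discrete fibration if for every $e\in\mathcal{E}$ and $\gamma\colon b\to pe$ in $\mathcal{B}$ there is a unique map $\gamma'$ of $\mathcal{E}$ with codomain $e$ and $p(\gamma')=\gamma$. A $2$-functor $F\colon\mathcal{K}\to\mathcal{L}$ is a local discrete fibration if each functor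 $\mathcal{K}(X,Y)\to\mathcal{L}(FX,FY)$ is a discrete fibration. *)

(* Defs.v *)
From Stdlib Require Import FunctionalExtensionality ProofIrrelevance.
From mathcomp Require Import ssreflect ssrfun ssrbool.

Set Implicit Arguments.
Unset Strict Implicit.
Unset Printing Implicit Defensive.

#[local] Obligation Tactic := idtac.

Reserved Notation "g \oc f" (at level 40, left associativity).

(* Equality of maps is Leibniz equality. Composition is in applicative order. *)
Record category := Category {
  obj :> Type;
  hom : obj -> obj -> Type;
  idm : forall a : obj, hom a a;
  compm : forall a b c : obj, hom b c -> hom a b -> hom a c;
  comp1m : forall (a b : obj) (f : hom a b), compm (idm b) f = f;
  compm1 : forall (a b : obj) (f : hom a b), compm f (idm a) = f;
  compmA : forall (a b c d : obj) (h : hom c d) (g : hom b c) (f : hom a b),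
    compm h (compm g f) = compm (compm h g) f
}.
Arguments hom {c} : rename.
Arguments idm {c} a : rename.
Arguments compm {c a b c0} : rename.
Notation "g \oc f" := (compm g f).

Record functor (C D : category) := Functor {
  fobj :> C -> D;
  fmap : forall a b : C, hom a b -> hom (fobj a) (fobj b);
  fmap1 : forall a : C, fmap (idm a) = idm (fobj a);
  fmapM : forall (a b c : C) (g : hom b c) (f : hom a b),
    fmap (g \oc f) = fmap g \oc fmap f
}.
Arguments fmap {C D} f {a b} : rename.

Lemma functor_thin_eq (C D : category) (F G : functor C D) :
  (forall (a b : D) (f g : hom a b), f = g) ->
  (forall a, F a = G a) -> F = G.
Proof.
case: F G => F0 F1 F2 F3 [G0 G1 G2 G3] thin /= eqFG.
have eqFG' : F0 = G0 by apply: functional_extensionality_dep.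
case: _ / eqFG' G1 G2 G3 {eqFG} => G1 G2 G3.
have eqFG1 : F1 = G1.
  apply: functional_extensionality_dep => a.
  apply: functional_extensionality_dep => b.
  by apply: functional_extensionality_dep => f; apply: thin.
case: _ / eqFG1 G2 G3 => G2 G3.
by rewrite (proof_irrelevance _ F2 G2) (proof_irrelevance _ F3 G3).
Qed.

Definition id_functor (C : category) : functor C C :=
  @Functor C C (fun a => a) (fun _ _ f => f)
    (fun _ => erefl) (fun _ _ _ _ _ => erefl).

Program Definition const_functor (C D : category) (d : D) : functor C D :=
  @Functor C D (fun _ => d) (fun _ _ _ => idm d) (fun _ => erefl) _.
Next Obligation. by move=> * /=; rewrite comp1m. Qed.

Program Definition comp_functor (C D E : category)
    (G : functor D E) (F : functor C D) : functor C E :=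
  @Functor C E (fun a => G (F a)) (fun _ _ f => fmap G (fmap F f)) _ _.
Next Obligation. by move=> * /=; rewrite !fmap1. Qed.
Next Obligation. by move=> * /=; rewrite !fmapM. Qed.

Program Definition prod_category (C D : category) : category :=
  @Category (C * D)%type
    (fun a b => (hom a.1 b.1 * hom a.2 b.2)%type)
    (fun a => (idm a.1, idm a.2))
    (fun _ _ _ g f => (g.1 \oc f.1, g.2 \oc f.2)) _ _ _.
Next Obligation. by move=> C D [a1 a2] [b1 b2] [f g] /=; rewrite !comp1m. Qed.
Next Obligation. by move=> C D [a1 a2] [b1 b2] [f g] /=; rewrite !compm1. Qed.
Next Obligation. by move=> * /=; rewrite !compmA. Qed.

Definition fst_functor (C D : category) : functor (prod_category C D) C :=
  @Functor (prod_category C D) C (fun a => a.1) (fun _ _ f => f.1)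
    (fun _ => erefl) (fun _ _ _ _ _ => erefl).

Definition snd_functor (C D : category) : functor (prod_category C D) D :=
  @Functor (prod_category C D) D (fun a => a.2) (fun _ _ f => f.2)
    (fun _ => erefl) (fun _ _ _ _ _ => erefl).

Program Definition pair_functor (B C D : category)
    (F : functor B C) (G : functor B D) : functor B (prod_category C D) :=
  @Functor B (prod_category C D) (fun a => (F a, G a))
    (fun _ _ f => (fmap F f, fmap G f)) _ _.
Next Obligation. by move=> * /=; rewrite !fmap1. Qed.
Next Obligation. by move=> * /=; rewrite !fmapM. Qed.

(* Strict 2-categories as Cat-enriched categories: the unit and associativity
   laws are equalities of functors, hence hold for 1-cells and for 2-cells. *)
Record two_category := TwoCategory {
  cell0 :> Type;
  cell1 : cell0 -> cell0 -> category;
  id1 : forall X : cell0, cell1 X X;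
  hcomp : forall X Y Z : cell0,
    functor (prod_category (cell1 Y Z) (cell1 X Y)) (cell1 X Z);
  hcomp1m : forall X Y : cell0,
    comp_functor (hcomp X Y Y)
      (pair_functor (const_functor (cell1 X Y) (id1 Y))
                    (id_functor (cell1 X Y)))
    = id_functor (cell1 X Y);
  hcompm1 : forall X Y : cell0,
    comp_functor (hcomp X X Y)
      (pair_functor (id_functor (cell1 X Y))
                    (const_functor (cell1 X Y) (id1 X)))
    = id_functor (cell1 X Y);
  hcompA : forall W X Y Z : cell0,
    let H := cell1 Y Z in let G := cell1 X Y in let F := cell1 W X in
    let prHG := fst_functor (prod_category H G) F in
    let prH := comp_functor (fst_functor H G) prHG in
    let prG := comp_functor (snd_functor H G) prHG in
    let prF := snd_functor (prod_category H G) F in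
    comp_functor (hcomp W Y Z)
      (pair_functor prH (comp_functor (hcomp W X Y) (pair_functor prG prF)))
    = comp_functor (hcomp W X Z)
      (pair_functor (comp_functor (hcomp X Y Z) prHG) prF)
}.
Arguments cell1 {t} X Y : rename.
Arguments id1 {t} X : rename.
Arguments hcomp {t} X Y Z : rename.

Record two_functor (K L : two_category) := TwoFunctor {
  tf_obj :> K -> L;
  tf_hom : forall X Y : K, functor (cell1 X Y) (cell1 (tf_obj X) (tf_obj Y));
  tf_id : forall X : K, tf_hom X X (id1 X) = id1 (tf_obj X);
  tf_hcomp : forall X Y Z : K,
    comp_functor (tf_hom X Z) (hcomp X Y Z)
    = comp_functor (hcomp (tf_obj X) (tf_obj Y) (tf_obj Z))
        (pair_functor
          (comp_functor (tf_hom Y Z) (fst_functor (cell1 Y Z) (cell1 X Y)))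
          (comp_functor (tf_hom X Y) (snd_functor (cell1 Y Z) (cell1 X Y))))
}.
Arguments tf_hom {K L} t X Y : rename.

(* A map with codomain e is a pair of its domain and the map itself; the
   equation p (g') = g includes the equation p (dom g') = b of objects. *)
Definition discrete_fibration (E B : category) (p : functor E B) : Prop :=
  forall (e : E) (b : B) (g : hom b (p e)),
    exists! g' : {e' : E & hom e' e},
      existT (fun b' : B => hom b' (p e)) (p (projT1 g')) (fmap p (projT2 g'))
      = existT (fun b' : B => hom b' (p e)) b g.

Definition local_discrete_fibration (K L : two_category)
    (F : two_functor K L) : Prop :=
  forall X Y : K, discrete_fibration (tf_hom F X Y).

Record restriction_category := RestrictionCategory {
  rcat :> category;
  rst : forall A B : rcat, hom A B -> hom A A;
  rst1 : forall (A B : rcat) (f : hom A B), f \oc rst f = f;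
  rst2 : forall (A B C : rcat) (f : hom A B) (g : hom A C),
    rst f \oc rst g = rst g \oc rst f;
  rst3 : forall (A B C : rcat) (f : hom A B) (g : hom A C),
    rst (g \oc rst f) = rst g \oc rst f;
  rst4 : forall (A B C : rcat) (f : hom A B) (g : hom B C),
    rst g \oc f = f \oc rst (g \oc f)
}.
Arguments rst {r A B} f : rename.

Record restriction_functor (C D : restriction_category) := RestrictionFunctor {
  rfun :> functor C D;
  fmap_rst : forall (A B : C) (f : hom A B),
    fmap rfun (rst f) = rst (fmap rfun f)
}.

Definition rle (C : restriction_category) (A B : C) (f g : hom A B) : Prop :=
  g \oc rst f = f.

Section RestrictionOrder.
Variable C : restriction_category.

Lemma rle_refl (A B : C) (f : hom A B) : rle f f.
Proof. exact: rst1. Qed.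

Lemma rle_trans (A B : C) (f g h : hom A B) : rle f g -> rle g h -> rle f h.
Proof.
rewrite /rle => fg gh.
by rewrite -{1}fg rst3 compmA gh.
Qed.

Lemma rle_comp (X Y Z : C) (g g' : hom Y Z) (f f' : hom X Y) :
  rle g g' -> rle f f' -> rle (g \oc f) (g' \oc f').
Proof.
rewrite /rle => gg' ff'.
have -> : rst (g \oc f) = rst f \oc rst (g \oc f).
  by rewrite rst2 -rst3 -compmA rst1.
by rewrite -compmA (compmA f') ff' -rst4 compmA gg'.
Qed.

End RestrictionOrder.

Lemma rle_fmap (C D : restriction_category) (F : restriction_functor C D)
    (A B : C) (f g : hom A B) : rle f g -> rle (fmap F f) (fmap F g).
Proof. by rewrite /rle => fg; rewrite -fmap_rst -fmapM fg. Qed.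

(* The poset of maps A -> B seen as a category: a map f -> g is a proof of
   f <= g, unique by proof irrelevance. *)
Program Definition Gamma_hom (C : restriction_category) (A B : C) : category :=
  @Category (hom A B) (fun f g => rle f g)
    (@rle_refl C A B) (fun f g h gh fg => rle_trans fg gh) _ _ _.
Next Obligation. by move=> *; apply: proof_irrelevance. Qed.
Next Obligation. by move=> *; apply: proof_irrelevance. Qed.
Next Obligation. by move=> *; apply: proof_irrelevance. Qed.

Lemma Gamma_hom_thin (C : restriction_category) (A B : C)
    (f g : Gamma_hom A B) (s t : hom f g) : s = t.
Proof. exact: (proof_irrelevance (rle (f : hom A B) g)). Qed.

Program Definition Gamma_hcomp (C : restriction_category) (X Y Z : C) :
    functor (prod_category (Gamma_hom Y Z) (Gamma_hom X Y)) (Gamma_hom X Z) :=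
  @Functor (prod_category (Gamma_hom Y Z) (Gamma_hom X Y)) (Gamma_hom X Z)
    (fun gf => gf.1 \oc gf.2) (fun _ _ s => rle_comp s.1 s.2) _ _.
Next Obligation. move=> *; exact: Gamma_hom_thin. Qed.
Next Obligation. move=> *; exact: Gamma_hom_thin. Qed.

Program Definition Gamma (C : restriction_category) : two_category :=
  @TwoCategory C (@Gamma_hom C) (fun X => idm X) (@Gamma_hcomp C) _ _ _.
Next Obligation.
move=> C X Y; apply: functor_thin_eq => [|f]; first exact: Gamma_hom_thin.
exact: comp1m.
Qed.
Next Obligation.
move=> C X Y; apply: functor_thin_eq => [|f]; first exact: Gamma_hom_thin.
exact: compm1.
Qed.
Next Obligation.
move=> C W X Y Z; apply: functor_thin_eq => [|f]; first exact: Gamma_hom_thin.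
exact: compmA.
Qed.

Program Definition Gamma_fmap (C D : restriction_category)
    (F : restriction_functor C D) (X Y : C) :
    functor (Gamma_hom X Y) (Gamma_hom (F X) (F Y)) :=
  @Functor (Gamma_hom X Y) (Gamma_hom (F X) (F Y))
    (fun f => fmap F f) (fun _ _ s => rle_fmap F s) _ _.
Next Obligation. move=> *; exact: Gamma_hom_thin. Qed.
Next Obligation. move=> *; exact: Gamma_hom_thin. Qed.

Program Definition Gamma_functor (C D : restriction_category)
    (F : restriction_functor C D) : two_functor (Gamma C) (Gamma D) :=
  @TwoFunctor (Gamma C) (Gamma D) F (Gamma_fmap F) _ _.
Next Obligation. by move=> C D F X; apply: fmap1. Qed.
Next Obligation.
move=> C D F X Y Z; apply: functor_thin_eq => [|f]; first exact: Gamma_hom_thin.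
exact: fmapM.
Qed.

Definition ridem (C : restriction_category) (A : C) : Type :=
  {e : hom A A | rst e = e}.

Program Definition ridem_map (C D : restriction_category)
    (F : restriction_functor C D) (A : C) (e : ridem A) : ridem (F A) :=
  exist _ (fmap F (sval e)) _.
Next Obligation. by move=> C D F A [e /= he]; rewrite -fmap_rst he. Qed.

Definition hyperconnected (C D : restriction_category)
    (F : restriction_functor C D) : Prop :=
  forall A : C, bijective (@ridem_map C D F A).

(* Main.v *)
From Stdlib Require Import ProofIrrelevance ClassicalEpsilon.
From mathcomp Require Import ssreflect ssrfun ssrbool.
Require Import Defs.

Set Implicit Arguments.
Unset Strict Implicit.
Unset Printing Implicit Defensive.

(** A map below [f : A -> B] is determined by its restriction: [g <= f] means
    [g = f \oc rst g], and conversely [f \oc e <= f] for every restriction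
    idempotent [e] on [A]. So lifting some [h <= F f] to a map below [f]
    amounts to lifting the restriction idempotent [rst h] along
    [O(A) -> O(F A)], and existence and uniqueness of one kind of lift follow
    from those of the other. In the opposite direction, the restriction
    idempotents on [A] are exactly the maps below [idm A], so bijectivity of
    [O(A) -> O(F A)] is the lifting property at [f = idm A].

    Both directions pass through [lifts_below], which is the local discrete
    fibration property freed of its dependent pairs: the 2-cells of [Gamma C]
    are proofs of inequalities, hence a 2-cell carries no information beyond
    its source and its target ([ldf_lifts_below]). *)

Section RestrictionIdempotents.
Variable C : restriction_category.

Lemma rst_idm (A : C) : rst (idm A) = idm A.
Proof. by rewrite -[LHS]comp1m rst1. Qed.

Lemma rst_rst (A B : C) (f : hom A B) : rst (rst f) = rst f.
Proof. by rewrite -[X in rst X = _]comp1m rst3 rst_idm comp1m. Qed.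

Lemma rle_idm (A : C) (e : hom A A) : rle e (idm A) <-> rst e = e.
Proof. by rewrite /rle comp1m. Qed.

Lemma rle_comp_ridem (A B : C) (f : hom A B) (e : hom A A) :
  rst e = e -> rle (f \oc e) f.
Proof. by move=> he; rewrite /rle -he rst3 compmA rst1. Qed.

End RestrictionIdempotents.

Definition lifts_below (C D : restriction_category)
    (F : restriction_functor C D) : Prop :=
  forall (A B : C) (f : hom A B) (h : hom (F A) (F B)), rle h (fmap F f) ->
    exists! g : hom A B, rle g f /\ fmap F g = h.

Section Lifting.
Variables (C D : restriction_category) (F : restriction_functor C D).

(** Two objects of a slice of a poset are equal as soon as their sources are,
    by irrelevance of the proofs of inequalities; this holds both upstairs,
    for the candidate lifts, and downstairs, for their images. *)
Lemma ldf_lifts_below :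
  local_discrete_fibration (Gamma_functor F) <-> lifts_below F.
Proof.
split=> [ldf A B f h hf | lifts A B f h hf].
  have [[g gf] [/= Eg uniq_g]] := ldf A B f h hf.
  have Fg : fmap F g = h by exact: (f_equal (@projT1 _ _) Eg).
  exists g; split=> // g' [g'f Fg'].
  have /= Eg' := uniq_g (existT (fun g : hom A B => rle g f) g' g'f).
  apply: (f_equal (@projT1 _ _) (Eg' _)).
  move: (rle_fmap F g'f) hf {Eg uniq_g Eg'}; rewrite Fg' => p q.
  by rewrite (proof_irrelevance _ p q).
have [g [[gf Fg] uniq_g]] := lifts A B f h hf.
exists (existT (fun g : hom A B => rle g f) g gf); split=> /=.
  move: (rle_fmap F gf) hf {uniq_g}; rewrite Fg => p q.
  by rewrite (proof_irrelevance _ p q).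
move=> [g' g'f] /= /(f_equal (@projT1 _ _)) /= Fg'.
have Egg' := uniq_g g' (conj g'f Fg').
move: g'f {Fg'}; rewrite -Egg' => g'f.
by rewrite (proof_irrelevance _ gf g'f).
Qed.

(** The lift of [h <= F f] is [f \oc e], where [e] is the restriction
    idempotent lying over [rst h]. *)
Lemma hyperconnected_lifts_below : hyperconnected F -> lifts_below F.
Proof.
move=> hypF A B f h hf.
have [lift liftK Klift] := hypF A.
pose rh : ridem (F A) := exist _ (rst h) (rst_rst h).
have lift_unique (e : ridem A) : fmap F (sval e) = rst h -> e = lift rh.
  move=> Fe; rewrite -[LHS]liftK; congr lift.
  by apply: eq_sig_hprop => [*|]; [exact: proof_irrelevance | exact: Fe].
have Flift : fmap F (sval (lift rh)) = rst h.
  exact: (f_equal sval (Klift rh)).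
exists (f \oc sval (lift rh)); split=> [|g [gf Fg]].
  split; first exact: rle_comp_ridem (svalP (lift rh)).
  by rewrite fmapM Flift.
rewrite -(lift_unique (exist _ (rst g) (rst_rst g))) //=.
by rewrite fmap_rst Fg.
Qed.

(** The inverse of [O(A) -> O(F A)] is obtained by unique choice from the
    lifting property at [idm A]. *)
Lemma lifts_below_hyperconnected : lifts_below F -> hyperconnected F.
Proof.
move=> lifts A.
have lift1 (h : ridem (F A)) :
    exists! g : hom A A, rle g (idm A) /\ fmap F g = sval h.
  by apply: lifts; rewrite fmap1; apply/rle_idm; exact: (svalP h).
have lift_ridem (h : ridem (F A)) : exists e : ridem A, ridem_map F e = h.
  have [g [[/rle_idm hg Fg] _]] := lift1 h; exists (exist (fun e => rst e = e) g hg).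
  by apply: eq_sig_hprop => [*|]; [exact: proof_irrelevance | exact: Fg].
pose lift h := sval (constructive_indefinite_description _ (lift_ridem h)).
have liftE h : ridem_map F (lift h) = h.
  exact: svalP (constructive_indefinite_description _ (lift_ridem h)).
exists lift => // e.
have [g [_ uniq_g]] := lift1 (ridem_map F e).
have g_eq (e' : ridem A) : ridem_map F e' = ridem_map F e -> g = sval e'.
  move=> Fe'; apply: uniq_g; split; first by apply/rle_idm; exact: (svalP e').
  exact: (f_equal sval Fe').
apply: eq_sig_hprop => [*|]; first exact: proof_irrelevance.
by rewrite -(g_eq e) // -(g_eq (lift _)) // liftE.
Qed.

End Lifting.

Theorem proposition4p1 (C D : restriction_category)
  (F : restriction_functor C D) :
  hyperconnected F <-> local_discrete_fibration (Gamma_functor F).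
Proof.
rewrite ldf_lifts_below; split.
  exact: hyperconnected_lifts_below.
exact: lifts_below_hyperconnected.
Qed.
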